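(* Let $n\ge1$ and $[n]=\{1,\dots,n\}$. Let $$\bar{\mathcal X}=\{(\mathbf x,\mathbf X,\mathbf z)\in\mathbb R^n\times\mathbb R^{n\times n}\times\{0,1\}^n:\ \mathbf X\succeq\mathbf x\mathbf x^\top,\ x_iz_i\ge0,\ x_i(1-z_i)\le0,\ i=1,\dots,n\}.$$ For any $S\subseteq[n]$, the two copositive constraints $$\begin{pmatrix}\sum_{i\in S}z_i&-\mathbf x_S^\top\\-\mathbf x_S&\mathbf X_S\end{pmatrix}\in\mathcal C_+^{|S|+1}\quad\text{and}\quad\begin{pmatrix}\sum_{i\in S}(1-z_i)&\mathbf x_S^\top\\\mathbf x_S&\mathbf X_S\end{pmatrix}\in\mathcal C_+^{|S|+1}$$ are satisfied by every $(\mathbf x,\mathbf X,\mathbf z)\in\bar{\mathcal X}$. Moreover, for $(\mathbf x,\mathbf X,\mathbf z)\in\mathbb R^n\times\mathbb R^{n\times n}\times\mathbb R^n$ with $\mathbf X\succeq\mathbf x\mathbf x^\top$, the condition $$(\mathbf x,\mathbf z,\langle\mathbf d\mathbf d^\top,\mathbf X\rangle)\in\mathrm{cl\,conv}(\mathcal X_{\mathbf d})\quad\text{for all }\mathbf d\in\mathbb R_+^n$$ holds if and only if the two copositive constraints above hold for all $S\subseteq[n]$.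
   Context: For $\mathbf d\in\mathbb R^n$, $\mathcal X_{\mathbf d}=\{(\mathbf x,\mathbf z,t)\in\mathbb R^n\times\{0,1\}^n\times\mathbb R: t\ge(\mathbf d^\top\mathbf x)^2,\ x_iz_i\ge0,\ x_i(1-z_i)\le0,\ i=1,\dots,n\}$, and $\mathrm{cl\,conv}$ denotes the closure of the convex hull. $\mathcal C_+^m=\{\mathbf Y\in\mathbb R^{m\times m}:\mathbf Y=\mathbf Y^\top,\ \mathbf v^\top\mathbf Y\mathbf v\ge0\ \forall\mathbf v\in\mathbb R_+^m\}$ is the cone of copositive matrices. $\mathbf X\succeq\mathbf x\mathbf x^\top$ means that $\mathbf X-\mathbf x\mathbf x^\top$ is symmetric positive semidefinite. $\mathbf x_S$ is the subvector of $\mathbf x$ indexed by $S$, and $\mathbf X_S$ is the submatrix of $\mathbf X$ with rows and columns indexed by $S$. $\langle\mathbf A,\mathbf B\rangle=\sum_{i,j}A_{ij}B_{ij}$. *)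

(* Defs.v *)
From HB Require Import structures.
From mathcomp Require Import all_boot all_order all_algebra.
From mathcomp Require Import all_classical all_reals all_analysis.

Set Implicit Arguments.
Unset Strict Implicit.
Unset Printing Implicit Defensive.

Import Order.TTheory GRing.Theory Num.Theory.
Import numFieldNormedType.Exports.

Local Open Scope classical_set_scope.
Local Open Scope ring_scope.

Section Defs.
Context {R : realType}.

Definition qform m (Y : 'M[R]_m) (v : 'cV[R]_m) : R := (v^T *m Y *m v) 0 0.

Definition nonneg_vec m (v : 'cV[R]_m) : Prop := forall i, 0 <= v i 0.

Definition psd m (Y : 'M[R]_m) : Prop :=
  Y = Y^T /\ forall v, 0 <= qform Y v.

Definition copositive m (Y : 'M[R]_m) : Prop :=
  Y = Y^T /\ forall v, nonneg_vec v -> 0 <= qform Y v.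

Definition frob m (A B : 'M[R]_m) : R := \sum_i \sum_j A i j * B i j.

Definition convex_hull (M : lmodType R) (A : set M) : set M :=
  smallest (@convex_set R M) A.

Section Sets.
Context {n : nat}.
Implicit Types (d x z : 'cV[R]_n) (X : 'M[R]_n) (S : {set 'I_n}).

Definition binary z : Prop := forall i, z i 0 = 0 \/ z i 0 = 1.

Definition sign_indicators x z : Prop :=
  forall i, 0 <= x i 0 * z i 0 /\ x i 0 * (1 - z i 0) <= 0.

(* [R^o] is [R] viewed as a module over itself; the product then carries both
   the vector-space structure and the topology of R^n x R^n x R. *)
Definition calX d : set ('cV[R]_n * 'cV[R]_n * R^o)%type :=
  [set p | [/\ binary p.1.2,
               (d^T *m p.1.1) 0 0 ^+ 2 <= p.2 &
               sign_indicators p.1.1 p.1.2]].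

Definition dominates_outer x X : Prop := psd (X - x *m x^T).

Definition Xbar : set ('cV[R]_n * 'M[R]_n * 'cV[R]_n)%type :=
  [set p | [/\ binary p.2,
               dominates_outer p.1.1 p.1.2 &
               sign_indicators p.1.1 p.2]].

Definition subvec S x : 'cV[R]_#|S| := \col_i x (enum_val i) 0.

Definition submx_on S X : 'M[R]_#|S| :=
  \matrix_(i, j) X (enum_val i) (enum_val j).

Definition pos_block S x X z : 'M[R]_(1 + #|S|) :=
  block_mx (\sum_(i in S) z i 0)%:M (- (subvec S x)^T)
           (- subvec S x)           (submx_on S X).

Definition neg_block S x X z : 'M[R]_(1 + #|S|) :=
  block_mx (\sum_(i in S) (1 - z i 0))%:M (subvec S x)^T
           (subvec S x)                   (submx_on S X).

End Sets.
End Defs.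

(* Main.v *)
(* Necessity: for v >= 0 and d >= 0 supported in S, the halfspace
   v^2 sum_S z_i - 2 v d^T x + t >= 0 contains calX d, because d^T x > 0 forces
   some z_i = 1 with i in S; it is closed and convex, and at t = d^T X d it is
   the quadratic form of the first block at (v, d_S).  The second block is the
   first one at (-x, 1 - z), and calX d is invariant under this reflection.

   Sufficiency: let S be the support of d and s = sum_S z_i, and assume
   a = d^T x > 0.  Copositivity says t s >= a^2, hence t p >= a^2 for
   p = min(1, s).  Draw an index i in S with probability z_i p / s (and none
   with probability 1 - p), set z_i = 1 and x = a / (p d_i) e_i, and choose the
   other entries of z in [0, 1] so that the mean is z: this is a point (y, z, t)
   of the hull with d^T y = a.  Finally any u with d^T u = 0, such as x - y, is
   a direction of the closed hull: for l -> 0 add weight l to the point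
   (u / l, 1_{u > 0}, 0) of calX d. *)
Require Import Defs.
From HB Require Import structures.
From mathcomp Require Import all_boot all_order all_algebra.
From mathcomp Require Import all_classical all_reals all_analysis.
From mathcomp Require Import ring lra.
Import Order.TTheory GRing.Theory Num.Theory.
Import numFieldNormedType.Exports.
Local Open Scope classical_set_scope.
Local Open Scope ring_scope.

Set Implicit Arguments.
Unset Strict Implicit.
Unset Printing Implicit Defensive.

Section Hull.
Variable R : realType.

(** * Convex combinations and convex hulls *)

Section ConvexHull.
Variables (M : lmodType R) (A : set M).

Lemma sub_convex_hull : A `<=` convex_hull A.
Proof. exact: sub_gen_smallest. Qed.

(** The hull is the intersection of the convex supersets of [A], and each of them contains the
    combination. *)
Lemma convex_hull_conv p q (l : R) : 0 <= l <= 1 ->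
  convex_hull A p -> convex_hull A q -> convex_hull A (l *: p + (1 - l) *: q).
Proof.
move=> /andP[l0 l1] Ap Aq B [Bcvx AB].
have := Bcvx p q (Itv01 l0 l1); rewrite !inE; apply.
- exact: Ap.
- exact: Aq.
Qed.

Lemma convex_hull_sub (B : set M) :
  (forall p q (l : R), 0 <= l <= 1 -> B p -> B q -> B (l *: p + (1 - l) *: q)) ->
  A `<=` B -> convex_hull A `<=` B.
Proof.
move=> Bcvx AB; apply: smallest_sub => // p q l; rewrite !inE => Bp Bq.
by apply: Bcvx => //; apply/andP; split.
Qed.

(* Stating the convex combination as a nonnegative multiple of a point of the
   hull avoids dividing by a possibly zero total weight. *)
Lemma convex_hull_sum (I : Type) (r : seq I) (P : pred I) (c : I -> R)
    (p : I -> M) p0 : convex_hull A p0 ->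
  (forall i, P i -> 0 <= c i /\ convex_hull A (p i)) ->
  exists2 q, convex_hull A q &
    \sum_(i <- r | P i) c i *: p i = (\sum_(i <- r | P i) c i) *: q.
Proof.
move=> Ap0 cp; elim: r => [|i r [q Aq IH]].
  by exists p0 => //; rewrite !big_nil scale0r.
rewrite !big_cons; case: ifPn => [Pi|_]; last by exists q.
have [ci0 Api] := cp i Pi; set C := \sum_(j <- r | P j) c j in IH *.
have C0 : 0 <= C by apply: sumr_ge0 => j /cp[].
have [cC0|cC0] := eqVneq (c i + C) 0.
  exists q => //; rewrite IH cC0 scale0r.
  have -> : c i = 0 by lra.
  have -> : C = 0 by lra.
  by rewrite !scale0r addr0.
have cC_gt0 : 0 < c i + C by rewrite lt_neqAle eq_sym cC0 addr_ge0.
exists (c i / (c i + C) *: p i + (1 - c i / (c i + C)) *: q).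
  apply: convex_hull_conv => //.
  by rewrite divr_ge0 ?(ltW cC_gt0)//= ler_pdivrMr// mul1r lerDl.
by rewrite IH scalerDr !scalerA; congr (_ *: _ + _ *: _); field.
Qed.

End ConvexHull.

(** The map [l] to [p + l *: r] is continuous at 0, so [p] is a limit from the right of points of
    [A]. *)
Lemma closure_affine_path (V : normedModType R) (A : set V) (p r : V) :
  (forall l : R, 0 < l < 1 -> A (p + l *: r)) -> closure A p.
Proof.
move=> Apr; have pr : p + l *: r @[l --> 0^'+] --> p.
  apply: cvg_at_right_filter; rewrite -[X in _ --> X]addr0 -(scale0r r).
  by apply: cvgD; [exact: cvg_cst|apply: cvgZr_tmp; exact: cvg_id].
apply: (closed_cvg _ (@closed_closure _ A) _ _ pr).
near=> l; apply: subset_closure; apply: Apr; apply/andP; split.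
  by near: l; exact: nbhs_right_gt.
by near: l; exact: nbhs_right_lt.
Unshelve. all: by end_near. Qed.

(** * Scalar products and the reflection of (x, z, t) to (-x, 1 - z, t) *)

Section CalX.
Variable n : nat.
Implicit Types (d x z u : 'cV[R]_n) (X : 'M[R]_n) (S : {set 'I_n}) (t : R).

Local Notation dot d x := ((d^T *m x) 0 0).

Lemma dotE d x : dot d x = \sum_i d i 0 * x i 0.
Proof. by rewrite mxE; apply: eq_bigr => i _; rewrite mxE. Qed.

Lemma dotDr d x u : dot d (x + u) = dot d x + dot d u.
Proof. by rewrite mulmxDr mxE. Qed.

Lemma dotNr d x : dot d (- x) = - dot d x.
Proof. by rewrite mulmxN mxE. Qed.

Lemma dotZr d x (a : R) : dot d (a *: x) = a * dot d x.
Proof. by rewrite -scalemxAr mxE. Qed.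

Definition compl z : 'cV[R]_n := const_mx 1 - z.

Lemma complE z i : compl z i 0 = 1 - z i 0.
Proof. by rewrite !mxE. Qed.

Lemma complK z : compl (compl z) = z.
Proof. by rewrite /compl subKr. Qed.

Lemma binary_compl z : binary z -> binary (compl z).
Proof.
by move=> bz i; rewrite complE; case: (bz i) => ->; rewrite ?subrr ?subr0; [right|left].
Qed.

Lemma sign_indicators_compl x z :
  sign_indicators x z -> sign_indicators (- x) (compl z).
Proof.
move=> xz i; have [h1 h2] := xz i; rewrite complE mxE; split; first lra.
by rewrite subKr; lra.
Qed.

Lemma calX_compl d x z t : calX d (x, z, t) -> calX d (- x, compl z, t).
Proof.
move=> [/= bz dxt xz]; split => /=; first exact: binary_compl.
- by rewrite dotNr sqrrN.
- exact: sign_indicators_compl.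
Qed.

(** The reflection is affine, so the preimage [B] of the hull is convex; it contains [calX d], hence
    the whole hull. *)
Lemma convex_hull_calX_compl d x z t :
  convex_hull (calX d) (x, z, t) -> convex_hull (calX d) (- x, compl z, t).
Proof.
pose B := [set p : ('cV[R]_n * 'cV[R]_n * R^o)%type |
  convex_hull (calX d) (- p.1.1, compl p.1.2, p.2)].
apply: (convex_hull_sub (B := B)) => [[[x1 z1] t1] [[x2 z2] t2] l l01|].
  rewrite /B /= => h1 h2.
  have := convex_hull_conv l01 h1 h2; congr (convex_hull _ _).
  congr (_, _, _); rewrite /=.
    by rewrite !scalerN opprD.
  by apply/colP => i; rewrite !mxE; ring.
by move=> [[x1 z1] t1] /calX_compl h; apply: sub_convex_hull.
Qed.

(** * Halfspaces containing [calX d] and its closed hull *)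

Lemma calX_pos_ineq d x z t S (v : R) : nonneg_vec d ->
  (forall i, i \notin S -> d i 0 = 0) -> 0 <= v ->
  binary z -> sign_indicators x z -> dot d x ^+ 2 <= t ->
  0 <= v ^+ 2 * (\sum_(i in S) z i 0) - 2 * v * dot d x + t.
Proof.
move=> d0 dS v0 bz xz dxt.
have z0 i : 0 <= z i 0 by case: (bz i) => ->.
have Sz0 : 0 <= \sum_(i in S) z i 0 by apply: sumr_ge0.
have [dx0|dx0] := lerP (dot d x) 0.
  by have := sqr_ge0 (dot d x); have := mulr_ge0 (sqr_ge0 v) Sz0; nra.
have [i iS xi] : exists2 i, i \in S & 0 < x i 0.
  apply: contrapT => noi; move: dx0; apply/negP; rewrite -leNgt dotE.
  apply: sumr_le0 => i _; have [iS|/dS ->] := boolP (i \in S); last by rewrite mul0r.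
  apply: mulr_ge0_le0 (d0 i) _; rewrite leNgt; apply/negP => xi.
  by apply: noi; exists i.
have zi : z i 0 = 1.
  by case: (bz i) => // zi0; have [_] := xz i; rewrite zi0; lra.
have Sz1 : 1 <= \sum_(i in S) z i 0.
  by rewrite (bigD1 i)//= zi lerDl; apply: sumr_ge0.
(* Since the sum is at least 1 and t >= (d^T x)^2, the expression is at least (v - d^T x)^2. *)
have := sqr_ge0 (v - dot d x); have := sqr_ge0 v; nra.
Qed.

(** The expression is a continuous affine function of [p], so its nonnegativity set is closed and
    convex. The constant [c] serves the reflected inequality, where each 1 - z_i contributes a
    constant. *)
Lemma closure_halfspace d S (a b c : R) :
  (forall p, calX d p ->
    0 <= a * (\sum_(i in S) p.1.2 i 0) + b * dot d p.1.1 + p.2 + c) ->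
  forall p, closure (convex_hull (calX d)) p ->
    0 <= a * (\sum_(i in S) p.1.2 i 0) + b * dot d p.1.1 + p.2 + c.
Proof.
move=> hX; pose f (p : 'cV[R]_n * 'cV[R]_n * R^o) : R :=
  a * (\sum_(i in S) p.1.2 i 0) + b * (\sum_i d i 0 * p.1.1 i 0) + p.2 + c.
have fE (p : 'cV[R]_n * 'cV[R]_n * R^o) :
    a * (\sum_(i in S) p.1.2 i 0) + b * dot d p.1.1 + p.2 + c = f p.
  by rewrite /f dotE.
have c1 i : continuous (fun p : 'cV[R]_n * 'cV[R]_n * R^o => p.1.1 i 0).
  move=> p; apply: (@continuous_comp _ _ _ (fun q => q.1.1) (fun M : 'cV[R]_n => M i 0)).
    by apply: (@continuous_comp _ _ _ fst fst); exact: cvg_fst.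
  exact: coord_continuous.
have c2 i : continuous (fun p : 'cV[R]_n * 'cV[R]_n * R^o => p.1.2 i 0).
  move=> p; apply: (@continuous_comp _ _ _ (fun q => q.1.2) (fun M : 'cV[R]_n => M i 0)).
    by apply: (@continuous_comp _ _ _ fst snd); [exact: cvg_fst|exact: cvg_snd].
  exact: coord_continuous.
have fcont : continuous f.
  move=> p; apply: cvgD; last exact: cvg_cst.
  apply: cvgD; last exact: cvg_snd.
  apply: cvgD; apply: cvgMl_tmp; apply: cvg_big => [|i _].
  - exact: add_continuous.
  - exact: c2.
  - exact: add_continuous.
  by apply: cvgMl_tmp; exact: c1.
move=> p pC; rewrite fE.
have fcl : closed (f @^-1` [set y | 0 <= y]).
  by apply: preimage_closed; [move=> q _; exact: fcont|exact: closed_ge].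
apply: (fcl p); apply: closure_subset pC.
apply: convex_hull_sub => [q r l /andP[l0 l1] /= fq fr|q /hX]; last by rewrite fE.
have -> : f (l *: q + (1 - l) *: r) = l * f q + (1 - l) * f r.
  rewrite -!fE /= dotDr !dotZr.
  have -> : \sum_(i in S) (l *: q.1.2 + (1 - l) *: r.1.2) i 0 =
      l * (\sum_(i in S) q.1.2 i 0) + (1 - l) * (\sum_(i in S) r.1.2 i 0).
    by rewrite !mulr_sumr -big_split; apply: eq_bigr => i _; rewrite !mxE.
  by rewrite /GRing.scale /=; ring.
by rewrite addr_ge0 ?mulr_ge0// subr_ge0.
Qed.

(** * Construction of points of the hull *)

(* A coordinate where [z] is not binary has [x i 0 = 0], so it can be rounded
   both to 0 and to 1. *)
Lemma convex_hull_calX_box d x z t : dot d x ^+ 2 <= t ->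
  (forall i, 0 <= z i 0 <= 1) ->
  (forall i, 0 < x i 0 -> z i 0 = 1) -> (forall i, x i 0 < 0 -> z i 0 = 0) ->
  convex_hull (calX d) (x, z, t).
Proof.
(* Induction on the number of nonbinary entries of [z]; rounding one of them lowers it. *)
move=> dxt; have [m] := ubnP #|[set i | (z i 0 != 0) && (z i 0 != 1)]%SET|.
elim: m z => // m IH z; rewrite ltnS => zm z01 xp xn.
have [bz|/existsNP[j /not_orP[/eqP zj0 /eqP zj1]]] := pselect (binary z).
  apply: sub_convex_hull; split => //= i.
  have [xi0|xi0|->] := ltrgtP (x i 0) 0; last by rewrite !mul0r.
  - by rewrite xn//; lra.
  - by rewrite xp//; lra.
have xj0 : x j 0 = 0.
  have [xj|xj|//] := ltrgtP (x j 0) 0.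
  - by rewrite xn ?eqxx in zj0.
  - by rewrite xp ?eqxx in zj1.
pose w (e : R) : 'cV[R]_n := \col_i if i == j then e else z i 0.
have wE e i : w e i 0 = if i == j then e else z i 0 by rewrite mxE.
have hw (e : R) : e = 0 \/ e = 1 -> convex_hull (calX d) (x, w e, t).
  move=> e01; apply: IH => [|i|i|i].
  - apply: leq_trans zm; apply: proper_card; apply/properP; split.
      apply/fintype.subsetP => i; rewrite !inE wE; case: (eqVneq i j) => // _.
      by case: e01 => ->; rewrite eqxx ?andbF.
    exists j; first by rewrite inE zj0.
    rewrite inE wE eqxx.
    by case: e01 => ->; rewrite eqxx ?andbF.
  - by rewrite wE; case: eqP => // _; case: e01 => ->; rewrite ?lexx ?ler01.
  - by rewrite wE; case: eqVneq => [->|_ /xp//]; rewrite xj0 ltxx.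
  - by rewrite wE; case: eqVneq => [->|_ /xn//]; rewrite xj0 ltxx.
have := convex_hull_conv (z01 j) (hw 1 (or_intror erefl)) (hw 0 (or_introl erefl)).
congr (convex_hull _ _); congr (_, _, _) => /=.
- by rewrite -scalerDl addrC subrK scale1r.
- apply/colP => i; rewrite !mxE; case: eqVneq => [->|_]; ring.
- by rewrite /GRing.scale /=; ring.
Qed.

Lemma exists_hull_point_gt0 d z t (a : R) : nonneg_vec d ->
  (forall i, 0 <= z i 0 <= 1) -> 0 < a -> a ^+ 2 <= t ->
  0 < \sum_(i in [set i | d i 0 != 0]%SET) z i 0 ->
  a ^+ 2 <= t * \sum_(i in [set i | d i 0 != 0]%SET) z i 0 ->
  exists2 x, dot d x = a & convex_hull (calX d) (x, z, t).
Proof.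
move=> d0 z01 a0 a2t; set S := [set i | d i 0 != 0]%SET; set s := \sum_(i in S) z i 0.
move=> s0 a2ts; pose p := Num.min 1 s.
have p0 : 0 < p by rewrite lt_min ltr01.
have p1 : p <= 1 by rewrite ge_min lexx.
have ps : p / s <= 1 by rewrite ler_pdivrMr// mul1r ge_min lexx orbT.
(* Each of the two bounds on a^2 covers one of the two values of the minimum. *)
have a2tp : a ^+ 2 <= t * p by rewrite /p /Num.min; case: ifP => _; rewrite ?mulr1.
have pN0 : p != 0 by rewrite gt_eqF.
(* The probability of drawing [i]: these sum to [p], and each is at most z_i because p <= s. *)
pose z' i := if i \in S then z i 0 * (p / s) else 0.
have z'0 i : 0 <= z' i.
  rewrite /z'; case: ifP => // _; have /andP[zi0 _] := z01 i.
  by rewrite mulr_ge0// divr_ge0// ltW.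
have z'z i : z' i <= z i 0.
  have /andP[zi0 _] := z01 i; rewrite /z'; case: ifP => // _.
  by rewrite -[leRHS]mulr1 ler_wpM2l.
have sz' : \sum_(i in S) z' i = p.
  rewrite (eq_bigr (fun i => z i 0 * (p / s))); last by move=> i; rewrite /z' => ->.
  by rewrite -mulr_suml -/s mulrC divfK ?gt_eqF.
(* When [z' i = 1] the quotient is [x / 0 = 0]; then [z i 0 = 1] as well. *)
pose q : 'cV[R]_n := \col_i ((z i 0 - z' i) / (1 - z' i)).
(* Entry [i] is 1 when [i] is drawn and [q i 0] otherwise, so its mean z'_i + (1 - z'_i) q_i is
   z_i. *)
have qE i : q i 0 * (1 - z' i) = z i 0 - z' i.
  rewrite mxE; have [z'1|z'1] := eqVneq (1 - z' i) 0; last by rewrite divfK.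
  by have := z'z i; have /andP[_ ] := z01 i; rewrite z'1; lra.
have q01 i : 0 <= q i 0 <= 1.
  have := z'z i; have /andP[_ zi1] := z01 i => z'i; rewrite mxE.
  have [z'1|z'1] := eqVneq (1 - z' i) 0; first by rewrite z'1 invr0 mulr0 lexx ler01.
  have z'1' : 0 < 1 - z' i by rewrite lt_neqAle eq_sym z'1 subr_ge0 (le_trans z'i).
  by rewrite ler_pdivrMr// mul1r lerD2r zi1 divr_ge0 ?subr_ge0// (le_trans z'i).
(* The slack of [t] over the mean p (a / p)^2 of the squares. It is added to every outcome,
   including the one without a draw. *)
pose r := t - a ^+ 2 / p.
have r0 : 0 <= r by rewrite subr_ge0 ler_pdivrMr.
pose c i := a / (p * d i 0).
pose P i : 'cV[R]_n * 'cV[R]_n * R^o :=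
  (c i *: delta_mx i 0, \col_j if j == i then 1 else q j 0, (a / p) ^+ 2 + r).
have dc i : i \in S -> dot d (c i *: delta_mx i 0 : 'cV[R]_n) = a / p.
  by rewrite inE => di0; rewrite dotZr -colE !mxE /c; field; apply/andP.
have hP i : i \in S -> convex_hull (calX d) (P i).
  move=> iS; move: (iS); rewrite inE => di0.
  have di : 0 < d i 0 by rewrite lt_neqAle eq_sym di0 d0.
  have ci : 0 < c i by rewrite divr_gt0 ?mulr_gt0.
  apply: convex_hull_calX_box => [|j|j|j].
  - by rewrite dc// lerDl.
  - by rewrite mxE; case: eqP => // _; rewrite ler01 lexx.
  - by rewrite !mxE; case: eqP => // _; rewrite mulr0 ltxx.
  - rewrite !mxE; case: eqP => //= _; last by rewrite mulr0 ltxx.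
    by rewrite mulr1 ltNge (ltW ci).
have hQ : convex_hull (calX d) (0, q, r).
  apply: convex_hull_calX_box => [|//|j|j].
  - by rewrite mulmx0 mxE expr0n.
  - by rewrite mxE ltxx.
  - by rewrite mxE ltxx.
have hc i : i \in S -> 0 <= z' i /\ convex_hull (calX d) (P i).
  by move=> iS; split; [exact: z'0|exact: hP].
(* (x1, z1, t1) is the mean given that some index is drawn; mixing it with (0, q, r) with weights p
   and 1 - p gives the point sought. *)
have [[[x1 z1] t1] h1] := convex_hull_sum (index_enum 'I_n) hQ hc.
rewrite sz' => hsum.
have p01 : 0 <= p <= 1 by rewrite (ltW p0).
have sum_fst (F : 'I_n -> 'cV[R]_n * 'cV[R]_n * R^o) :
    (\sum_(i in S) F i).1 = \sum_(i in S) (F i).1.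
  exact: (big_morph fst (fun _ _ => erefl) erefl).
have sum_snd (F : 'I_n -> 'cV[R]_n * 'cV[R]_n * R^o) :
    (\sum_(i in S) F i).2 = \sum_(i in S) (F i).2.
  exact: (big_morph snd (fun _ _ => erefl) erefl).
have hx : p *: x1 = \sum_(i in S) z' i *: (c i *: delta_mx i 0).
  have := congr1 (fun w => w.1.1) hsum; rewrite /= sum_fst => <-.
  exact: (big_morph fst (fun _ _ => erefl) erefl).
have hz : p *: z1 = \sum_(i in S) z' i *: (\col_j if j == i then 1 else q j 0).
  have := congr1 (fun w => w.1.2) hsum; rewrite /= sum_fst => <-.
  exact: (big_morph snd (fun _ _ => erefl) erefl).
have ht : p * t1 = p * ((a / p) ^+ 2 + r).
  have := congr1 snd hsum; rewrite sum_snd /= -scaler_suml sz'.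
  by move=> /esym.
exists (p *: x1).
  rewrite hx mulmx_sumr summxE (eq_bigr (fun i => z' i * (a / p))); last first.
    by move=> i iS; rewrite dotZr dc.
  by rewrite -mulr_suml sz' mulrC divfK.
have := convex_hull_conv p01 h1 hQ; congr (convex_hull _ _).
congr (_, _, _) => /=; first by rewrite scaler0 addr0.
- apply/colP => j; rewrite hz mxE summxE [X in _ + X]mxE.
  (* Entry [j] is q_j plus the correction 1 - q_j when [j] is drawn, so the first part sums to p q_j
     and the correction to z'_j (1 - q_j). *)
  rewrite (eq_bigr (fun i => z' i * q j 0 +
    (if i == j then z' j * (1 - q j 0) else 0))); last first.
    by move=> i _; rewrite !mxE eq_sym; case: eqVneq => [->|_]; ring.
  rewrite big_split /= -mulr_suml sz' -big_mkcondr /=.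
  have -> : \sum_(i in S | i == j) z' j * (1 - q j 0) = z' j * (1 - q j 0).
    case: (boolP (j \in S)) => jS.
      rewrite (big_pred1 j)// => i; rewrite andbC /=.
      by case: eqP => //= ->.
    have z'j : z' j = 0 by rewrite /z' (negbTE jS).
    by rewrite z'j mul0r big1.
  by have := qE j; lra.
- rewrite /GRing.scale /= ht /r; field.
  exact: pN0.
Qed.

Lemma closure_shift d x u z t : dot d u = 0 ->
  convex_hull (calX d) (x, z, t) -> closure (convex_hull (calX d)) (x + u, z, t).
Proof.
move=> du hx; pose y : 'cV[R]_n := \col_i if 0 < u i 0 then 1 else 0.
(* Mixing (u / l, y, 0) and (x, z, t) with weights l and 1 - l gives (x + u, z, t) + l (-x, y - z,
   -t), an affine path ending at the desired point. *)
apply: (@closure_affine_path _ _ ((x + u, z, t) : 'cV[R]_n * 'cV[R]_n * R^o)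
  (- x, y - z, - t)) => l /andP[l0 l1].
have hu : convex_hull (calX d) (l^-1 *: u, y, 0).
  apply: sub_convex_hull; split => /= [i||i].
  - by rewrite mxE; case: ifP; [right|left].
  - by rewrite dotZr du mulr0 expr0n.
  - rewrite !mxE; have [ui|ui] := ltrP 0 (u i 0).
      by rewrite subrr !mulr0 mulr1 mulr_ge0// ltW// invr_gt0.
    by rewrite mulr0 subr0 mulr1 lexx pmulr_rle0 ?invr_gt0.
have l01 : 0 <= l <= 1 by rewrite !ltW.
have := convex_hull_conv l01 hu hx; congr (convex_hull _ _); congr (_, _, _) => /=.
- by rewrite scalerA divff ?gt_eqF// scale1r scalerBl scale1r scalerN addrC addrAC.
- by apply/colP => i; rewrite !mxE; ring.
- by rewrite /GRing.scale /=; ring.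
Qed.

(** Choosing [v] well in the quadratic condition yields s > 0 and (d^T x)^2 <= t s, as needed to
    draw an index. If d^T x = 0, the point y = 0 suffices. *)
Lemma exists_hull_point_nonneg d x z t : nonneg_vec d ->
  (forall i, 0 <= z i 0 <= 1) -> dot d x ^+ 2 <= t -> 0 <= dot d x ->
  (forall v : R, 0 <= v ->
    0 <= v ^+ 2 * (\sum_(i in [set i | d i 0 != 0]%SET) z i 0) - 2 * v * dot d x + t) ->
  exists2 y, dot d y = dot d x & convex_hull (calX d) (y, z, t).
Proof.
move=> d0 z01 dxt; rewrite le_eqVlt => /predU1P[dx0 _|dx0 hv].
  exists 0; first by rewrite -dx0 mulmx0 mxE.
  apply: convex_hull_calX_box => // [|i|i].
  - by rewrite mulmx0 mxE dx0.
  - by rewrite mxE ltxx.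
  - by rewrite mxE ltxx.
move: hv; set s := \sum_(i in _) z i 0 => hv.
have t0 : 0 <= t by apply: le_trans dxt; exact: sqr_ge0.
have s_ge0 : 0 <= s by apply: sumr_ge0 => i _; have /andP[] := z01 i.
have s0 : 0 < s.
  rewrite lt_neqAle s_ge0 andbT; apply/eqP => s0.
  (* With s = 0 the condition is linear in [v], and at this value it would read 0 <= -1. *)
  have v0 : 0 <= (t + 1) / (2 * dot d x).
    by apply: divr_ge0; [exact: addr_ge0|rewrite mulr_ge0// ltW].
  have := hv _ v0; rewrite -s0 mulr0.
  have -> : 2 * ((t + 1) / (2 * dot d x)) * dot d x = t + 1.
    by field; rewrite gt_eqF.
  by lra.
apply: exists_hull_point_gt0 => //; rewrite -/s.
(* The minimiser of the quadratic in [v]. *)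
have v0 : 0 <= dot d x / s by rewrite divr_ge0 ?ltW.
have := hv _ v0.
have -> : (dot d x / s) ^+ 2 * s - 2 * (dot d x / s) * dot d x + t =
  t - dot d x ^+ 2 / s by field; rewrite gt_eqF.
by rewrite subr_ge0 ler_pdivrMr.
Qed.

Lemma closure_hull_calX d x z t : nonneg_vec d ->
  (forall i, 0 <= z i 0 <= 1) -> dot d x ^+ 2 <= t ->
  (forall v : R, 0 <= v ->
    0 <= v ^+ 2 * (\sum_(i in [set i | d i 0 != 0]%SET) z i 0) - 2 * v * dot d x + t) ->
  (forall v : R, 0 <= v ->
    0 <= v ^+ 2 * (\sum_(i in [set i | d i 0 != 0]%SET) (1 - z i 0))
      + 2 * v * dot d x + t) ->
  closure (convex_hull (calX d)) (x, z, t).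
Proof.
move=> d0 z01 dxt hpos hneg.
have [y dy hy] : exists2 y, dot d y = dot d x & convex_hull (calX d) (y, z, t).
  have [dx0|/ltW dx0] := lerP 0 (dot d x); first exact: exists_hull_point_nonneg.
  (* When d^T x < 0, the nonnegative case applies to (-x, 1 - z), and the point found is reflected
     back. *)
  have [|||v v0|y dy /convex_hull_calX_compl] :=
      @exists_hull_point_nonneg d (- x) (compl z) t d0.
  - by move=> i; rewrite complE; have := z01 i; lra.
  - by rewrite dotNr sqrrN.
  - by rewrite dotNr oppr_ge0.
  - rewrite dotNr mulrN opprK (eq_bigr (fun i => 1 - z i 0)); first exact: hneg.
    by move=> i _; rewrite complE.
  - by rewrite complK => hy; exists (- y) => //; rewrite dotNr dy dotNr opprK.
rewrite -(subrK y x) addrC; apply: closure_shift => //.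
by rewrite dotDr dotNr dy subrr.
Qed.

(** * Copositivity of the blocks as scalar inequalities *)

Lemma dotC d x : dot d x = dot x d.
Proof. by rewrite !dotE; apply: eq_bigr => i _; rewrite mulrC. Qed.

Section Blocks.
Variable S : {set 'I_n}.

(** Multiplication by this matrix extends a vector indexed by [S] by zero; its transpose restricts
    to [S]. *)
Definition incidence : 'M[R]_(n, #|S|) := \matrix_(i, k) (i == enum_val k)%:R.

Lemma subvecE x : subvec S x = incidence^T *m x.
Proof.
apply/colP => k; rewrite !mxE (bigD1 (enum_val k))//= !mxE eqxx mul1r.
by rewrite big1 ?addr0// => i ik; rewrite !mxE (negbTE ik) mul0r.
Qed.

Lemma submx_onE X : submx_on S X = incidence^T *m X *m incidence.
Proof.
apply/matrixP => k l; rewrite !mxE (bigD1 (enum_val l))//= !mxE eqxx mulr1.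
rewrite [X in _ + X]big1 ?addr0; last by move=> i ik; rewrite !mxE (negbTE ik) mulr0.
rewrite (bigD1 (enum_val k))//= !mxE eqxx mul1r.
by rewrite big1 ?addr0// => i ik; rewrite !mxE (negbTE ik) mul0r.
Qed.

Lemma incidence_notin (w : 'cV[R]_#|S|) i : i \notin S -> (incidence *m w) i 0 = 0 :> R.
Proof.
move=> iS; rewrite mxE big1// => k _; rewrite mxE; case: eqVneq => [ik|_].
  by rewrite ik enum_valP in iS.
by rewrite mul0r.
Qed.

Lemma incidence_nonneg (w : 'cV[R]_#|S|) : nonneg_vec w -> nonneg_vec (incidence *m w).
Proof.
by move=> w0 i; rewrite mxE; apply: sumr_ge0 => k _; rewrite mxE mulr_ge0.
Qed.

Lemma incidence_subvec d : (forall i, i \notin S -> d i 0 = 0) ->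
  incidence *m subvec S d = d.
Proof.
move=> dS; apply/colP => i; have [iS|iS] := boolP (i \in S); last first.
  by rewrite incidence_notin ?dS.
rewrite mxE (bigD1 (enum_rank_in iS i))//= !mxE enum_rankK_in// eqxx mul1r.
rewrite big1 ?addr0// => k ki; rewrite !mxE; case: eqVneq => [ik|_].
  by move: ki; rewrite -(inj_eq enum_val_inj) enum_rankK_in// -ik eqxx.
by rewrite mul0r.
Qed.

Lemma qform_pos_block x X z (v : 'cV[R]_(1 + #|S|)) :
  qform (pos_block S x X z) v =
  usubmx v 0 0 ^+ 2 * (\sum_(i in S) z i 0)
  - 2 * usubmx v 0 0 * dot (incidence *m dsubmx v) x
  + qform X (incidence *m dsubmx v).
Proof.
set a := usubmx v 0 0; set w := dsubmx v; set s := \sum_(i in S) _.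
have ax : (w^T *m subvec S x) 0 0 = dot (incidence *m w) x.
  by rewrite subvecE mulmxA trmx_mul.
have xa : ((subvec S x)^T *m w) 0 0 = dot (incidence *m w) x.
  by rewrite subvecE trmx_mul trmxK -mulmxA dotC.
have Xw : (w^T *m submx_on S X *m w) 0 0 = qform X (incidence *m w).
  by rewrite submx_onE /qform trmx_mul !mulmxA.
have va : usubmx v = a%:M by rewrite [LHS]mx11_scalar.
rewrite -Xw -xa; rewrite -xa in ax.
rewrite /qform -{1 2}(vsubmxK v) va -/w /pos_block -/s.
rewrite tr_col_mx mul_row_block mul_row_col tr_scalar_mx !mul_scalar_mx.
rewrite !mulmxDl !mul_mx_scalar !mulmxN -!scalemxAl mulNmx.
(* The two cross terms are 1 x 1 matrices with the same entry, whence the factor 2. *)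
move: ax; move: (w^T *m subvec S x) ((subvec S x)^T *m w).
by move: (w^T *m submx_on S X *m w) => A B C BC; rewrite !mxE BC eqxx mulr1n; ring.
Qed.

Lemma neg_block_pos x X z : neg_block S x X z = pos_block S (- x) X (compl z).
Proof.
rewrite /neg_block /pos_block; have -> : subvec S (- x) = - subvec S x.
  by apply/colP => i; rewrite !mxE.
rewrite raddfN !opprK; congr (block_mx _%:M _ _ _).
by apply: eq_bigr => i _; rewrite complE.
Qed.

Lemma pos_block_sym x X z : X = X^T -> pos_block S x X z = (pos_block S x X z)^T.
Proof.
move=> XT; rewrite /pos_block tr_block_mx tr_scalar_mx !linearN /= trmxK.
congr (block_mx _ _ _ _).
by apply/matrixP => i j; rewrite !mxE XT mxE -XT.
Qed.

(** Extension by zero and restriction match the nonnegative vectors of the block with the pairs of v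
    >= 0 and d >= 0 supported in [S]. This puts all blocks in terms of vectors of R^n. *)
Lemma copositive_pos_blockP x X z : X = X^T ->
  copositive (pos_block S x X z) <->
  forall (d : 'cV[R]_n) (v : R), nonneg_vec d ->
    (forall i, i \notin S -> d i 0 = 0) -> 0 <= v ->
    0 <= v ^+ 2 * (\sum_(i in S) z i 0) - 2 * v * dot d x + qform X d.
Proof.
move=> XT; split => [[_ h] d v d0 dS v0|h].
  have := h (col_mx v%:M (subvec S d)); rewrite qform_pos_block.
  rewrite col_mxKu col_mxKd incidence_subvec// mxE eqxx mulr1n; apply.
  by move=> i; rewrite mxE; case: splitP => k _; rewrite mxE // ord1 eqxx mulr1n.
split => [|v v0]; first exact: pos_block_sym.
rewrite qform_pos_block; apply: h.
- by apply: incidence_nonneg => i; rewrite mxE.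
- exact: incidence_notin.
- by rewrite mxE.
Qed.

End Blocks.

(** * Consequences of X - x x^T being semidefinite, and necessity *)

Lemma qformBouter x X d : qform (X - x *m x^T) d = qform X d - dot d x ^+ 2.
Proof.
rewrite /qform mulmxBr mulmxBl mxE [X in _ + X]mxE; congr (_ - _).
have -> : d^T *m (x *m x^T) *m d = (d^T *m x) *m (x^T *m d) by rewrite !mulmxA.
by rewrite {1}[d^T *m x]mx11_scalar mul_scalar_mx mxE (dotC x) expr2.
Qed.

Lemma frob_outer X d : frob (d *m d^T) X = qform X d.
Proof.
rewrite /frob /qform mxE exchange_big; apply: eq_bigr => j _ /=.
rewrite mxE mulr_suml; apply: eq_bigr => i _.
by rewrite !mxE big_ord1 !mxE; ring.
Qed.

Lemma dominates_outer_sym x X : dominates_outer x X -> X = X^T.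
Proof.
by case; rewrite raddfB /= trmx_mul trmxK => /addIr.
Qed.

Lemma dominates_outer_sqr x X d : dominates_outer x X -> dot d x ^+ 2 <= qform X d.
Proof. by case=> _ /(_ d); rewrite qformBouter subr_ge0. Qed.

Lemma dominates_outerN x X : dominates_outer x X -> dominates_outer (- x) X.
Proof. by rewrite /dominates_outer raddfN mulNmx mulmxN opprK. Qed.

(** Semidefiniteness gives (d^T x)^2 <= d^T X d, so (x, z, d^T X d) meets the conditions of [calX d]
    for every [d]. *)
Lemma Xbar_copositive S x X z : Xbar (x, X, z) -> copositive (pos_block S x X z).
Proof.
move=> [/= bz dom xz]; apply/copositive_pos_blockP; first exact: dominates_outer_sym dom.
move=> d v d0 dS v0; apply: calX_pos_ineq => //; exact: dominates_outer_sqr.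
Qed.

Lemma Xbar_compl x X z : Xbar (x, X, z) -> Xbar (- x, X, compl z).
Proof.
move=> [/= bz dom xz]; split => /=; first exact: binary_compl.
- exact: dominates_outerN.
- exact: sign_indicators_compl.
Qed.

Lemma closure_calX_pos_ineq d x z t S (v : R) : nonneg_vec d ->
  (forall i, i \notin S -> d i 0 = 0) -> 0 <= v ->
  closure (convex_hull (calX d)) (x, z, t) ->
  0 <= v ^+ 2 * (\sum_(i in S) z i 0) - 2 * v * dot d x + t.
Proof.
move=> d0 dS v0 cl.
have := @closure_halfspace d S (v ^+ 2) (- (2 * v)) 0 _ _ cl.
rewrite /= mulNr addr0; apply => -[[y w] s] [/= bw dy yw].
by rewrite mulNr addr0; exact: calX_pos_ineq.
Qed.

(** Writing the sum of 1 - z_i as |S| minus the sum of z_i exhibits this as another halfspace in (x,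
    z, t), so the reflection is applied only to points of [calX d] and not to the closure. *)
Lemma closure_calX_neg_ineq d x z t S (v : R) : nonneg_vec d ->
  (forall i, i \notin S -> d i 0 = 0) -> 0 <= v ->
  closure (convex_hull (calX d)) (x, z, t) ->
  0 <= v ^+ 2 * (\sum_(i in S) compl z i 0) - 2 * v * dot d (- x) + t.
Proof.
move=> d0 dS v0 cl.
have sum_compl (w : 'cV[R]_n) :
    \sum_(i in S) compl w i 0 = #|S|%:R - \sum_(i in S) w i 0.
  by rewrite (eq_bigr _ (fun i _ => complE w i)) sumrB sumr_const.
have := @closure_halfspace d S (- v ^+ 2) (2 * v) (v ^+ 2 * #|S|%:R) _ _ cl.
rewrite /= sum_compl dotNr => h.
apply: le_trans (h _) _ => [[[y w] s] [/= bw dy yw]|]; last first.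
  by rewrite le_eqVlt; apply/orP; left; apply/eqP; ring.
have := @calX_pos_ineq d (- y) (compl w) s S v d0 dS v0 (binary_compl bw).
move=> /(_ (sign_indicators_compl yw)); rewrite dotNr sqrrN sum_compl => /(_ dy).
by move=> /le_trans; apply; rewrite le_eqVlt; apply/orP; left; apply/eqP; ring.
Qed.

End CalX.
End Hull.

Theorem corollary2 (R : realType) (n : nat) (n_ge1 : (1 <= n)%N) :
  (forall (S : {set 'I_n}) (x : 'cV[R]_n) (X : 'M[R]_n) (z : 'cV[R]_n),
      Xbar (x, X, z) ->
      copositive (pos_block S x X z) /\ copositive (neg_block S x X z)) /\
  (forall (x : 'cV[R]_n) (X : 'M[R]_n) (z : 'cV[R]_n),
      dominates_outer x X ->
      ((forall d : 'cV[R]_n, nonneg_vec d ->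
          closure (convex_hull (calX d)) (x, z, frob (d *m d^T) X))
       <->
       (forall S : {set 'I_n},
          copositive (pos_block S x X z) /\ copositive (neg_block S x X z)))).
Proof.
split=> [S x X z xXz|x X z dom].
  by split; rewrite ?neg_block_pos; apply: Xbar_copositive => //; exact: Xbar_compl.
have XT := dominates_outer_sym dom; split => [cl S|cop d d0].
  split; rewrite ?neg_block_pos; apply/copositive_pos_blockP => // d v d0 dS v0.
  - by rewrite -frob_outer; apply: closure_calX_pos_ineq => //; exact: cl.
  - by rewrite -frob_outer; apply: closure_calX_neg_ineq => //; exact: cl.
have pos S := (copositive_pos_blockP S x z XT).1 (cop S).1.
have neg (S : {set 'I_n}) (d' : 'cV[R]_n) (v : R) (d'0 : nonneg_vec d')
    (dS : forall i, i \notin S -> d' i 0 = 0) (v0 : 0 <= v) :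
    0 <= v ^+ 2 * (\sum_(i in S) (1 - z i 0)) + 2 * v * (d'^T *m x) 0 0 + qform X d'.
  have := (cop S).2; rewrite neg_block_pos => /copositive_pos_blockP.
  move=> /(_ XT d' v d'0 dS v0); rewrite dotNr mulrN opprK.
  by rewrite (eq_bigr _ (fun i _ => complE z i)).
rewrite frob_outer; apply: closure_hull_calX => // [i||v v0|v v0].
(* For S = {i}, d = 0 and v = 1 the two inequalities reduce to z_i >= 0 and 1 - z_i >= 0. *)
- have zero0 : nonneg_vec (0 : 'cV[R]_n) by move=> k; rewrite mxE.
  have zeroS k : k \notin [set i]%SET -> (0 : 'cV[R]_n) k 0 = 0 by rewrite mxE.
  have := pos _ 0 1 zero0 zeroS ler01; have := neg _ 0 1 zero0 zeroS ler01.
  rewrite !big_set1 /qform !(mulmx0, trmx0, mul0mx) !mxE; lra.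
- exact: dominates_outer_sqr.
(* Here [S] is the support of [d]. *)
- by apply: pos => // i; rewrite inE negbK => /eqP.
- by apply: neg => // i; rewrite inE negbK => /eqP.
Qed.
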